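(* Let $d$ be a positive integer, let $Q$ be an indexed set of polynomials, let $c$ be a cut-off function for $Q$, let $w$ be a positive integer, and let $p$ be a polynomial of degree at most $2d$. Then $$\sup\{r\in\mathbb{R} : Q\vdash^c_{w,2d}p\geq r\}=\inf\{E(p) : E\in\mathscr{E}^c_{w,2d}(Q)\}.$$ Moreover, if the set $\mathscr{E}^c_{w,2d}(Q)$ is non-empty, then there is a pseudo-expectation achieving the infimum; i.e., $\min\{E(p) : E\in\mathscr{E}^c_{w,2d}(Q)\}$ is well-defined.
   Context: $\mathbb{R}[x]$ is the ring of real polynomials in the $2n$ commuting variables $x_1,\ldots,x_n,\bar{x}_1,\ldots,\bar{x}_n$ ($n$ pairs of twin variables). $B_n=\{x_i^2-x_i,\ \bar{x}_i^2-\bar{x}_i,\ x_i+\bar{x}_i-1 : i\in[n]\}$, where $[n]=\{1,\ldots,n\}$. The usual convention $\deg(0)=-\infty$ is used. Suprema and infima are taken in the extended reals, with $\inf\emptyset=+\infty$. An indexed set of polynomials $Q=\{q_1,\ldots,q_\ell,p_1,\ldots,p_m\}\subseteq\mathbb{R}[x]$ is interpreted as the constraints $q_1\geq 0,\ldots,q_\ell\geq 0$, $p_1=0,\ldots,p_m=0$. A PS proof of $p\geq 0$ from $Q$ is a formal identity $$p=s_\emptyset+\sum_{J\in\mathscr{J}}s_J\prod_{j\in J}q_j+\sum_{j\in[m]}t_jp_j+\sum_{q\in B_n}u_qq,$$ where $\mathscr{J}$ is a collection of non-empty subsets of $[\ell]$, each $s_J$ is a sum of squares of polynomials, and the $t_j,u_q$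 are arbitrary polynomials. It has product-width at most $w$ if each $J\in\mathscr{J}$ has cardinality at most $w$. A cut-off function for $Q$ is a function $c$ from the disjoint union of the power set of $[\ell]$ and $[m]$ to $\mathbb{N}$ with $c(J)\geq\sum_{j\in J}\deg(q_j)$ for each $J\subseteq[\ell]$ and $c(j)\geq\deg(p_j)$ for each $j\in[m]$. A PS proof $p=s_\emptyset+\sum_{J\in\mathscr{J}}s_J\prod_{j\in J}q_j+\sum_{j\in[m]}t_jp_j+\sum_{q\in B_n}u_qq$ of $p\geq 0$ from $Q$ has degree mod $c$ at most $d$ if $\deg(p)\leq d$, $\deg(s_\emptyset)\leq d$, $\deg(s_J)\leq d-c(J)$ for each $J\in\mathscr{J}$, and $\deg(t_j)\leq d-c(j)$ for each $j\in[m]$. $\mathrm{PS}^c_{w,d}(Q)$ is the set of polynomials $q$ of degree at most $d$ such that $q\geq 0$ has a PS proof from $Q$ of degree mod $c$ at most $d$ and product-width at most $w$. $Q\vdash^c_{w,d}q\geq p$ means $q-p\in\mathrm{PS}^c_{w,d}(Q)$. $\mathscr{E}^c_{w,d}(Q)$ is the set of pseudo-expectations: linear functionals $E$ from the space of polynomials of degree at most $d$ to $\mathbb{R}$ such that $E(1)=1$ and $E(q)\geq 0$ for all $q\in\mathrm{PS}^c_{w,d}(Q)$. *)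

(* Defs.v *)
From HB Require Import structures.
(* mpoly has to be imported before constructive_ereal: in the other order their
   notations clash. *)
From mathcomp Require Import all_boot all_order all_algebra.
From mathcomp.multinomials Require Import mpoly.
From mathcomp Require Import boolp classical_sets reals constructive_ereal ereal.

Set Implicit Arguments.
Unset Strict Implicit.
Unset Printing Implicit Defensive.

Import Order.TTheory GRing.Theory Num.Theory.

Local Open Scope ring_scope.

(* Polynomials in n pairs of twin variables: x_i is indexed by the left half of
   'I_(n + n) and its twin by the right half. *)
Notation tpoly R n := {mpoly R[n + n]}.

Definition xvar (R : realType) (n : nat) (i : 'I_n) : tpoly R n :=
  'X_(lshift n i).

Definition xtwin (R : realType) (n : nat) (i : 'I_n) : tpoly R n :=
  'X_(rshift n i).

Definition boolean_axioms (R : realType) (n : nat) : seq (tpoly R n) :=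
  flatten [seq [:: xvar R i ^+ 2 - xvar R i;
                   xtwin R i ^+ 2 - xtwin R i;
                   xvar R i + xtwin R i - 1] | i <- enum 'I_n].

(* The total degree with deg 0 = -oo; msize p is 1 + the total degree of p when
   p != 0. *)
Definition deg (R : realType) (n : nat) (p : tpoly R n) : \bar int :=
  if p == 0 then -oo%E else ((msize p).-1%:Z)%:E.

Definition deg_le (R : realType) (n d : nat) : {pred tpoly R n} :=
  fun p => (deg p <= d%:Z%:E)%E.

Lemma deg_leE (R : realType) (n d : nat) (p : tpoly R n) :
  (p \in @deg_le R n d) = (msize p <= d.+1)%N.
Proof.
rewrite /deg_le unfold_in /deg; case: eqP => [->|/eqP p0].
  by rewrite leNye msize0.
rewrite lee_fin lez_nat; have : msize p != 0%N by rewrite msize_poly_eq0.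
by case: (msize p).
Qed.

Lemma deg_le_submod_closed (R : realType) (n d : nat) :
  submod_closed (@deg_le R n d).
Proof.
split=> [|a p q]; rewrite !deg_leE ?msize0 // => hp hq.
apply: leq_trans (msizeD_le _ _) _.
by rewrite geq_max hq andbT (leq_trans (msizeZ_le _ _)).
Qed.

HB.instance Definition _ (R : realType) (n d : nat) :=
  GRing.isSubmodClosed.Build R (tpoly R n) (@deg_le R n d)
    (@deg_le_submod_closed R n d).

(* The vector space of polynomials of degree at most d. *)
Record bpoly (R : realType) (n d : nat) : predArgType :=
  BPoly { bpoly_val :> tpoly R n; bpolyP : bpoly_val \in @deg_le R n d }.

HB.instance Definition _ (R : realType) (n d : nat) :=
  [isSub for @bpoly_val R n d].
HB.instance Definition _ (R : realType) (n d : nat) :=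
  [Choice of @bpoly R n d by <:].
HB.instance Definition _ (R : realType) (n d : nat) :=
  [SubChoice_isSubLmodule of @bpoly R n d by <:].

Lemma deg_le1 (R : realType) (n d : nat) : 1 \in @deg_le R n d.
Proof. by rewrite deg_leE msize1. Qed.

Definition bpoly1 (R : realType) (n d : nat) : bpoly R n d :=
  BPoly (@deg_le1 R n d).

(* The constraints q_j >= 0 and p_j = 0. *)
Record constraints (R : realType) (n : nat) := Constraints {
  num_ineq : nat;
  num_eq : nat;
  ineq : 'I_num_ineq -> tpoly R n;
  eqc : 'I_num_eq -> tpoly R n
}.

Definition cutoff_type (R : realType) (n : nat) (Q : constraints R n) :=
  ({set 'I_(num_ineq Q)} + 'I_(num_eq Q) -> nat)%type.

Definition is_cutoff (R : realType) (n : nat) (Q : constraints R n)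
    (c : cutoff_type Q) : Prop :=
  (forall J : {set 'I_(num_ineq Q)},
     (\sum_(j in J) deg (ineq j) <= (c (inl J))%:Z%:E)%E) /\
  (forall j : 'I_(num_eq Q), (deg (eqc j) <= (c (inr j))%:Z%:E)%E).

Definition sos (R : realType) (n : nat) (s : tpoly R n) : Prop :=
  exists fs : seq (tpoly R n), s = \sum_(f <- fs) f ^+ 2.

(* ps_sq and ps_bool are total for convenience: only the values of ps_sq on
   ps_coll and of ps_bool on the Boolean axioms are ever used. *)
Record ps_data (R : realType) (n : nat) (Q : constraints R n) := PSData {
  ps_coll : {set {set 'I_(num_ineq Q)}};
  ps_sq0 : tpoly R n;
  ps_sq : {set 'I_(num_ineq Q)} -> tpoly R n;
  ps_eqc : 'I_(num_eq Q) -> tpoly R n;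
  ps_bool : tpoly R n -> tpoly R n
}.

Definition is_ps_proof (R : realType) (n : nat) (Q : constraints R n)
    (P : ps_data Q) (p : tpoly R n) : Prop :=
  [/\ finset.set0 \notin ps_coll P,
      sos (ps_sq0 P),
      (forall J, J \in ps_coll P -> sos (ps_sq P J)) &
      p = ps_sq0 P
          + \sum_(J in ps_coll P) ps_sq P J * \prod_(j in J) ineq j
          + \sum_(j < num_eq Q) ps_eqc P j * eqc j
          + \sum_(b <- boolean_axioms R n) ps_bool P b * b].

Definition product_width_le (R : realType) (n : nat) (Q : constraints R n)
    (P : ps_data Q) (w : nat) : Prop :=
  forall J, J \in ps_coll P -> (#|J| <= w)%N.

(* Subtraction is in int: when the cut-off exceeds d, only the zero polynomial
   is allowed. The multipliers of the Boolean axioms are not constrained. *)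
Definition degree_mod_le (R : realType) (n : nat) (Q : constraints R n)
    (c : cutoff_type Q) (P : ps_data Q) (p : tpoly R n) (d : nat) : Prop :=
  [/\ (deg p <= d%:Z%:E)%E,
      (deg (ps_sq0 P) <= d%:Z%:E)%E,
      (forall J, J \in ps_coll P ->
         (deg (ps_sq P J) <= (d%:Z - (c (inl J))%:Z)%:E)%E) &
      (forall j : 'I_(num_eq Q),
         (deg (ps_eqc P j) <= (d%:Z - (c (inr j))%:Z)%:E)%E)].

Definition PS (R : realType) (n : nat) (Q : constraints R n)
    (c : cutoff_type Q) (w d : nat) : set (tpoly R n) :=
  fun q => (deg q <= d%:Z%:E)%E /\
    exists P : ps_data Q,
      [/\ is_ps_proof P q, degree_mod_le c P q d & product_width_le P w].

Definition derives (R : realType) (n : nat) (Q : constraints R n)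
    (c : cutoff_type Q) (w d : nat) (q p : tpoly R n) : Prop :=
  PS c w d (q - p).

Definition pseudo_expectations (R : realType) (n : nat) (Q : constraints R n)
    (c : cutoff_type Q) (w d : nat) : set {scalar bpoly R n d} :=
  fun E => E (bpoly1 R n d) = 1 /\
    forall q : bpoly R n d, PS c w d q -> 0 <= E q.
Arguments pseudo_expectations {R n Q} c w d _.

(* Main.v *)
(* The polynomials of degree at most 2d with a PS proof form a convex cone, and
   1 is an order unit of it: writing a monomial as x * y with x and y of degree
   at most d, and r = 1 or r = -1, modulo the Boolean axioms
     2 (1 - r x y) = (x - r y)^2 + (1 - x)^2 + (1 - y)^2,
   because monomials are idempotent. If -1 is in the cone, the supremum is +oo
   and there is no pseudo-expectation. Otherwise let s be the supremum of the r
   with p - r in the cone; the cone remains free of -1 after adding the line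
   spanned by p - s, and Zorn's lemma extends it to a maximal cone K free of -1.
   By maximality, for every v there is a unique real E(v) with v - E(v) and
   E(v) - v in K, and E is a pseudo-expectation with E(p) = s. The cone need not
   be closed. *)
From HB Require Import structures.
Require Import Defs.
From mathcomp Require Import all_boot all_order all_algebra.
From mathcomp.multinomials Require Import mpoly.
From mathcomp Require Import boolp classical_sets reals constructive_ereal ereal.
From mathcomp Require Import ring.

Set Implicit Arguments.
Unset Strict Implicit.
Unset Printing Implicit Defensive.

Import Order.TTheory GRing.Theory Num.Theory.

Local Open Scope classical_set_scope.
Local Open Scope ring_scope.

(** * Convex cones with an order unit, and the states on them *)

Definition convex_cone (R : realType) (V : lmodType R) (K : set V) : Prop :=
  [/\ K 0, (forall x y, K x -> K y -> K (x + y)) &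
      (forall a x, 0 <= a -> K x -> K (a *: x))].

Definition order_unit (R : realType) (V : lmodType R) (K : set V) (e : V) :
    Prop :=
  forall v, exists r : R, K (r *: e - v).

Section Cone.
Context {R : realType} {V : lmodType R} {e : V}.
Implicit Types (K C : set V) (u v : V) (r s : R).

Lemma cone_unit_ge0 K r : convex_cone K -> ~ K (- e) -> K (r *: e) -> 0 <= r.
Proof.
move=> [_ _ KZ] Ke Kr; rewrite leNgt; apply/negP => r0; apply: Ke.
have -> : - e = (- r)^-1 *: (r *: e).
  by rewrite scalerA invrN mulNr mulVf ?lt_eqF// scaleN1r.
by apply: KZ => //; rewrite invr_ge0 oppr_ge0 ltW.
Qed.

Lemma cone_unit_le K v r s : convex_cone K -> ~ K (- e) ->
  K (v - r *: e) -> K (s *: e - v) -> r <= s.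
Proof.
move=> Kc Ke Kr Ks; rewrite -subr_ge0; apply: (cone_unit_ge0 Kc Ke).
have [_ KD _] := Kc.
have -> : (s - r) *: e = (s *: e - v) + (v - r *: e).
  by rewrite addrA subrK scalerBl.
exact: KD.
Qed.

Lemma cone_has_sup K v : convex_cone K -> order_unit K e -> ~ K (- e) ->
  has_sup [set r | K (v - r *: e)].
Proof.
move=> Kc eU Ke; split.
  have [r Kr] := eU (- v); exists (- r) => /=.
  by rewrite scaleNr opprK addrC -[v]opprK.
have [s Ks] := eU v; exists s => r Kr.
exact: (cone_unit_le Kc Ke Kr Ks).
Qed.

(** [K'] is [K] plus the line spanned by [v - r *: e]. Only the defining property of the supremum
    enters, so [v - r *: e] itself may lie outside [K]. *)
Lemma cone_extend K v : convex_cone K -> order_unit K e -> ~ K (- e) ->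
  let r := sup [set r | K (v - r *: e)] in
  exists K' : set V, [/\ convex_cone K', K `<=` K', ~ K' (- e),
    K' (v - r *: e) & K' (r *: e - v)].
Proof.
move=> Kc eU Ke r; have [K0 KD KZ] := Kc.
have Ksup : has_sup [set r | K (v - r *: e)] by exact: cone_has_sup.
exists [set y | exists x (t : R), K x /\ y = x + t *: (v - r *: e)]; split.
- split.
  + by exists 0, 0; rewrite scale0r addr0.
  + move=> _ _ [x [t [Kx ->]]] [y [s [Ky ->]]].
    exists (x + y), (t + s); split; first exact: KD.
    by rewrite scalerDl addrACA.
  + move=> a _ a0 [x [t [Kx ->]]]; exists (a *: x), (a * t).
    by split; [exact: KZ|rewrite scalerDr scalerA].
- by move=> x Kx; exists x, 0; rewrite scale0r addr0.
- move=> [x [t [Kx ex]]].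
  have xE : x = t *: (r *: e - v) - e.
    by rewrite ex addrC -addrA -scalerDr addrA subrK subrr scaler0 addr0.
  (* Dividing [x] by [|t|] contradicts the choice of [r]. For [t < 0] it puts [r - t^-1 > r] in the
     set whose supremum is [r]; for [t > 0] it makes [r - t^-1 < r] an upper bound of that set. *)
  have [t0|t0|t0] := ltgtP t 0.
  + have Kr : K (v - (r - t^-1) *: e).
      have -> : v - (r - t^-1) *: e = (- t)^-1 *: x.
        rewrite xE scalerBr scalerA invrN mulNr mulVf ?lt_eqF//.
        by rewrite scaleN1r opprB scaleNr opprK scalerBl opprB addrA addrAC.
      by apply: KZ => //; rewrite invr_ge0 oppr_ge0 ltW.
    have : r - t^-1 <= r by apply: ub_le_sup => //; case: Ksup.
    by rewrite gerBl leNgt invr_lt0 t0.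
  + have Kr : K ((r - t^-1) *: e - v).
      have -> : (r - t^-1) *: e - v = t^-1 *: x.
        by rewrite xE scalerBr scalerA mulVf ?gt_eqF// scale1r scalerBl addrAC.
      by apply: KZ => //; rewrite invr_ge0 ltW.
    have ti : 0 < t^-1 by rewrite invr_gt0.
    have [s Ks] := sup_adherent ti Ksup.
    by rewrite ltNge (cone_unit_le Kc Ke Ks Kr).
  + by apply: Ke; rewrite ex t0 scale0r addr0.
- by exists 0, 1; rewrite scale1r add0r.
- by exists 0, (-1); rewrite scaleN1r add0r opprB.
Qed.

Lemma cone_maximal C : convex_cone C -> ~ C (- e) ->
  exists K, [/\ convex_cone K, C `<=` K, ~ K (- e) &
    forall K', convex_cone K' -> K `<=` K' -> ~ K' (- e) -> K' `<=` K].
Proof.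
move=> Cc Ce; have [C0 CD CZ] := Cc.
(* Adjoining C makes the empty chain admissible for Zorn's lemma. *)
pose P A := convex_cone (C `|` A) /\ ~ (C `|` A) (- e).
have [|A [[Ac Ae] Amax]] := @Zorn_bigcup V P.
  move=> F FP Ftot; split.
    split; first by left.
    (* Since [F] is a chain, two elements not both in [C] lie in [C] joined with a single member of
       [F], which is a cone by [FP]. *)
    - move=> x y [Cx|[X FX Xx]] [Cy|[Y FY Yy]].
      + by left; exact: CD.
      + have [[_ YD _] _] := FP _ FY.
        have [Cxy|Yxy] := YD x y (or_introl Cx) (or_intror Yy); first by left.
        by right; exists Y.
      + have [[_ XD _] _] := FP _ FX.
        have [Cxy|Xxy] := XD x y (or_intror Xx) (or_introl Cy); first by left.
        by right; exists X.
      + have [XY|YX] := Ftot _ _ FX FY.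
        * have [[_ YD _] _] := FP _ FY.
          have [Cxy|Yxy] := YD x y (or_intror (XY _ Xx)) (or_intror Yy).
            by left.
          by right; exists Y.
        * have [[_ XD _] _] := FP _ FX.
          have [Cxy|Xxy] := XD x y (or_intror Xx) (or_intror (YX _ Yy)).
            by left.
          by right; exists X.
    - move=> a x a0 [Cx|[X FX Xx]]; first by left; exact: CZ.
      have [[_ _ XZ] _] := FP _ FX.
      have [Cax|Xax] := XZ a x a0 (or_intror Xx); first by left.
      by right; exists X.
  by case=> // -[X FX Xe]; have [_] := FP _ FX; apply; right.
exists (C `|` A); split=> // K' K'c KK' K'e.
(* A competitor [K'] already contains [C], so it satisfies [P] itself and the maximality of [A]
   applies to it. *)
have CK' : C `|` K' = K'.
  by apply/setUidPr => x Cx; apply: KK'; left.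
have AK' : A `<=` K' by move=> x Ax; apply: KK'; right.
apply: contrapT => nK'; apply: (Amax K').
  split=> // K'A; apply: nK' => x K'x; right; exact: K'A.
by split; rewrite CK'.
Qed.

(** [cone_extend] serves twice: once on [C], before maximising, to pin the value at [v], and then on
    the maximal cone [K] to give every [u] a value. Linearity comes from uniqueness, because the
    relation [H] respects sums and scalings. *)
Lemma state_exists C v : convex_cone C -> order_unit C e -> ~ C (- e) ->
  exists E : {scalar V}, [/\ E e = 1, (forall u, C u -> 0 <= E u) &
    E v = sup [set r | C (v - r *: e)]].
Proof.
move=> Cc eU Ce; have [C1 [C1c CC1 C1e vC1 C1v]] := cone_extend v Cc eU Ce.
have [K [Kc C1K Ke Kmax]] := cone_maximal C1c C1e.
have CK : C `<=` K := subset_trans CC1 C1K.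
have eK : order_unit K e by move=> u; have [r /CK] := eU u; exists r.
have [K0 KD KZ] := Kc.
pose H u r := K (u - r *: e) /\ K (r *: e - u).
have Hu u r s : H u r -> H u s -> r = s.
  move=> [r1 r2] [s1 s2]; apply/eqP; rewrite eq_le.
  by rewrite (cone_unit_le Kc Ke r1 s2) (cone_unit_le Kc Ke s1 r2).
(* Maximality forces the extension of [K] by the line of [u - r *: e] back into [K]. *)
have HE u : exists r, H u r.
  have [K' [K'c KK' K'e uK' K'u]] := cone_extend u Kc eK Ke.
  by eexists; split; apply: (Kmax _ K'c KK' K'e); [exact: uK'|exact: K'u].
have HD u1 u2 r1 r2 : H u1 r1 -> H u2 r2 -> H (u1 + u2) (r1 + r2).
  move=> [h1 h1'] [h2 h2']; rewrite /H scalerDl !opprD !(addrACA _ _ (- _)).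
  by split; exact: KD.
have HZ a u r : H u r -> H (a *: u) (a * r).
  move=> [h h']; rewrite /H -!scalerA -!scalerBr.
  have [a0|a0] := leP 0 a; first by split; exact: KZ.
  (* A negative factor exchanges the two memberships in [H]. *)
  by split; rewrite -[a]opprK scaleNr -scalerN opprB; apply: KZ => //;
    rewrite oppr_ge0 ltW.
have [f fH] := choice HE.
have flin : scalar f.
  by move=> a x y; apply: Hu (fH _) _; apply: HD => //; exact: HZ.
pose E : {scalar V} := HB.pack f (GRing.isLinear.Build R V R _ f flin).
exists E; split=> /=.
- by apply: Hu (fH _) _; rewrite /H scale1r subrr.
- move=> u /CK Ku; apply: (cone_unit_le Kc Ke) (fH u).2.
  by rewrite scale0r subr0.
- by apply: Hu (fH _) _; split; exact: C1K.
Qed.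

End Cone.

(** * Degree bounds, sums of squares and the Boolean ideal *)

Section PSCone.
Context {R : realType} {n : nat}.
Implicit Types (p q s : tpoly R n) (a r : R) (z : int).
Implicit Types (Q : constraints R n) (w d : nat).

(** The bound is an integer since the allowance left by a cut-off can be negative. For [z < -1] the
    size inequality fails even at 0, hence the separate disjunct. *)
Lemma deg_le_intE p z :
  (deg p <= z%:E)%E = (p == 0) || ((msize p)%:Z <= z + 1).
Proof.
rewrite /deg; case: eqP => [|/eqP p0]; first by rewrite leNye.
have : msize p != 0%N by rewrite msize_poly_eq0.
by case: (msize p) => // k _; rewrite lee_fin /= -addn1 PoszD lerD2r.
Qed.

Lemma deg0_le z : (deg (0 : tpoly R n) <= z%:E)%E.
Proof. by rewrite deg_le_intE eqxx. Qed.

Lemma deg_leD p q z :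
  (deg p <= z%:E)%E -> (deg q <= z%:E)%E -> (deg (p + q) <= z%:E)%E.
Proof.
have [->|p0] := eqVneq p 0; first by rewrite add0r.
have [->|q0] := eqVneq q 0; first by rewrite addr0.
rewrite !deg_le_intE (negbTE p0) (negbTE q0) /= => hp hq; apply/orP; right.
apply: le_trans (_ : (maxn (msize p) (msize q))%:Z <= _).
  by rewrite lez_nat msizeD_le.
by rewrite /maxn; case: ifP.
Qed.

Lemma deg_leZ a p z : (deg p <= z%:E)%E -> (deg (a *: p) <= z%:E)%E.
Proof.
have [->|p0] := eqVneq p 0; first by rewrite scaler0.
rewrite !deg_le_intE (negbTE p0) /= => hp; apply/orP; right.
by apply: le_trans hp; rewrite lez_nat msizeZ_le.
Qed.

Lemma deg_le_sqr p (d : nat) :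
  (msize p <= d.+1)%N -> (deg (p ^+ 2)%R <= (2 * d)%N%:Z%:E)%E.
Proof.
move=> hp; have [->|p0] := eqVneq p 0; first by rewrite expr0n deg0_le.
have := deg_leE (2 * d) (p ^+ 2); rewrite unfold_in => ->.
rewrite expr2 msizeM//; case: (msize p) hp => [//|k]; rewrite ltnS => hk.
by rewrite addSn addnS !ltnS mul2n -addnn leq_add.
Qed.

Lemma sos0 : sos (0 : tpoly R n).
Proof. by exists [::]; rewrite big_nil. Qed.

Lemma sosD p q : sos p -> sos q -> sos (p + q).
Proof. by move=> [fs ->] [gs ->]; exists (fs ++ gs); rewrite big_cat. Qed.

Lemma sos_sqr p : sos (p ^+ 2).
Proof. by exists [:: p]; rewrite big_seq1. Qed.

Lemma sosZ a p : 0 <= a -> sos p -> sos (a *: p).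
Proof.
move=> a0 [fs ->]; exists [seq Num.sqrt a *: f | f <- fs].
by rewrite big_map scaler_sumr; apply: eq_bigr => f _; rewrite exprZn sqr_sqrtr.
Qed.

(** Multipliers are indexed by the axiom itself, as in [ps_bool], so that a witness can be used in a
    [ps_data] unchanged. *)
Definition boolean_ideal p : Prop :=
  exists u : tpoly R n -> tpoly R n, p = \sum_(b <- boolean_axioms R n) u b * b.

Lemma boolean_idealD p q :
  boolean_ideal p -> boolean_ideal q -> boolean_ideal (p + q).
Proof.
move=> [u ->] [v ->]; exists (fun b => u b + v b); rewrite -big_split /=.
by apply: eq_bigr => b _; rewrite mulrDl.
Qed.

Lemma boolean_idealM p q : boolean_ideal q -> boolean_ideal (p * q).
Proof.
move=> [u ->]; exists (fun b => p * u b); rewrite big_distrr /=.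
by apply: eq_bigr => b _; rewrite mulrA.
Qed.

Lemma boolean_ideal_axiom p : p \in boolean_axioms R n -> boolean_ideal p.
Proof.
move=> pB; pose k := count_mem p (boolean_axioms R n).
(* All occurrences of p in the list get the same multiplier, hence the division
   by their number. *)
exists (fun b => if b == p then (k%:R^-1 : R)%:MP else 0).
rewrite (eq_bigr (fun b => if b == p then (k%:R^-1 : R) *: p else 0)).
  rewrite -big_mkcond big_const_seq iter_addr_0 scalerMnl.
  rewrite -[X in X *: _]mulr_natr mulVf ?scale1r// pnatr_eq0 -lt0n -has_count.
  by rewrite has_pred1.
by move=> b _; case: eqP => [->|_]; rewrite ?mul0r// mul_mpolyC.
Qed.

(** Idempotents modulo the ideal include 1 and are closed under products; the axioms make each
    variable one of them. *)
Lemma mpolyX_idem (m : 'X_{1..n + n}) :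
  boolean_ideal ('X_[m] ^+ 2 - 'X_[m]).
Proof.
have ideal0 : boolean_ideal 0.
  by exists (fun=> 0); rewrite big1// => b _; rewrite mul0r.
pose idem p := boolean_ideal (p ^+ 2 - p).
have idem1 : idem 1 by rewrite /idem expr1n subrr.
have idemM p q : idem p -> idem q -> idem (p * q).
  move=> hp hq; rewrite /idem.
  have -> : (p * q) ^+ 2 - p * q = p ^+ 2 * (q ^+ 2 - q) + q * (p ^+ 2 - p).
    by ring.
  by apply: boolean_idealD; exact: boolean_idealM.
have idemX (i : 'I_(n + n)) : idem 'X_i.
  apply: boolean_ideal_axiom; apply/flattenP.
  case: (splitP i) => j ij.
    have -> : i = lshift n j by exact: val_inj.
    exists [:: xvar R j ^+ 2 - xvar R j; xtwin R j ^+ 2 - xtwin R j;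
               xvar R j + xtwin R j - 1]; last by rewrite inE eqxx.
    by apply: map_f; rewrite mem_enum.
  have -> : i = rshift n j by exact: val_inj.
  exists [:: xvar R j ^+ 2 - xvar R j; xtwin R j ^+ 2 - xtwin R j;
             xvar R j + xtwin R j - 1]; last by rewrite !inE eqxx orbT.
  by apply: map_f; rewrite mem_enum.
rewrite mpolyXE_id; apply: (big_ind idem) => // i _.
by elim: (m i) => [|k IHk]; rewrite ?expr0// exprS; exact: idemM.
Qed.

(** Variables are moved one at a time into the first factor. With [i = j = d] this keeps the squares
    built from the two factors within degree [2 * d]. *)
Lemma mnm_split (k : nat) (i j : nat) (m : 'X_{1..k}) :
  (mdeg m <= i + j)%N ->
  exists m1 m2, [/\ m = (m1 + m2)%MM, (mdeg m1 <= i)%N & (mdeg m2 <= j)%N].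
Proof.
elim: i m => [|i IHi] m hm.
  by exists 0%MM, m; rewrite add0m mdeg0.
have [m0|/eqP/mnmP mn0] := eqVneq m 0%MM.
  by exists 0%MM, 0%MM; rewrite m0 addm0 mdeg0.
have [l ml] : exists l, (0 < m l)%N.
  apply: contrapT => nl; apply: mn0 => l; rewrite mnm0E; apply/eqP.
  by rewrite -leqn0 leqNgt; apply/negP => ml; apply: nl; exists l.
have ule : (U_(l) <= m)%MM by rewrite lep1mP -lt0n.
have /IHi[m1 [m2 [mE h1 h2]]] : (mdeg (m - U_(l)) <= i + j)%N.
  by move: hm; rewrite -{1}(submK ule) mdegD mdeg1 addn1 addSn ltnS.
exists (m1 + U_(l))%MM, m2; split=> //; last by rewrite mdegD mdeg1 addn1.
by rewrite -addmA [(U_(l) + _)%MM]addmC addmA -mE submK.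
Qed.

(** * The cone of provable polynomials and its order unit *)

Lemma big_mulDl (I : Type) (r : seq I) (f g F : I -> tpoly R n) :
  \sum_(i <- r) (f i + g i) * F i =
  \sum_(i <- r) f i * F i + \sum_(i <- r) g i * F i.
Proof. by rewrite -big_split; apply: eq_bigr => i _; rewrite mulrDl. Qed.


(** The proof built here calls on no constraint of [Q], so it respects every cut-off and width; the
    Boolean multipliers carry no degree bound, so congruence modulo the ideal is enough. *)
Lemma PS_sos Q (c : cutoff_type Q) w d p q :
  sos p -> (deg p <= d%:Z%:E)%E -> (deg q <= d%:Z%:E)%E ->
  boolean_ideal (q - p) -> PS c w d q.
Proof.
move=> sp dp dq [u hu]; split=> //.
exists (@PSData R n Q finset.set0 p (fun=> 0) (fun=> 0) u); split.
- split=> //=; rewrite ?inE//; first by move=> J; rewrite inE.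
  rewrite big_set0 addr0 big1 ?addr0 => [|j _]; last by rewrite mul0r.
  by rewrite -hu addrC subrK.
- by split=> //= [J|j]; rewrite ?inE// deg0_le.
- by move=> J /=; rewrite inE.
Qed.

Lemma PS0 Q (c : cutoff_type Q) w d : PS c w d 0.
Proof.
apply: (@PS_sos Q c w d 0); [exact: sos0|exact: deg0_le|exact: deg0_le|].
by exists (fun=> 0); rewrite subrr big1// => b _; rewrite mul0r.
Qed.

Lemma PSZ Q (c : cutoff_type Q) w d a p : 0 <= a ->
  PS c w d p -> PS c w d (a *: p).
Proof.
move=> a0 [dp [P [[P0 s0 sJ pE] [_ d0 dJ de] Pw]]]; split; first exact: deg_leZ.
exists (PSData (ps_coll P) (a *: ps_sq0 P) (fun J => a *: ps_sq P J)
  (fun j => a *: ps_eqc P j) (fun b => a *: ps_bool P b)); split=> //.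
- split=> //=; [exact: sosZ|by move=> J /sJ; exact: sosZ|].
  rewrite {1}pE !scalerDr !scaler_sumr.
  by congr (_ + _ + _ + _); apply: eq_bigr => x _; rewrite scalerAl.
- split=> /=; [exact: deg_leZ|exact: deg_leZ|by move=> J /dJ; exact: deg_leZ|].
  by move=> j; exact: deg_leZ.
Qed.

Lemma PSD Q (c : cutoff_type Q) w d p q :
  PS c w d p -> PS c w d q -> PS c w d (p + q).
Proof.
move=> [dp [P [[P0 s0 sJ pE] [_ d0 dJ de] Pw]]].
move=> [dq [S [[S0 t0 tJ qE] [_ e0 eJ ee] Sw]]]; split; first exact: deg_leD.
(* [ps_sq P] is arbitrary outside [ps_coll P]; it is cut to 0 there before summing over the union of
   the two collections. *)
pose sq (P : ps_data Q) J := if J \in ps_coll P then ps_sq P J else 0.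
exists (PSData (ps_coll P :|: ps_coll S) (ps_sq0 P + ps_sq0 S)
  (fun J => sq P J + sq S J) (fun j => ps_eqc P j + ps_eqc S j)
  (fun b => ps_bool P b + ps_bool S b)); split.
- split=> /=.
  + by rewrite inE negb_or P0 S0.
  + exact: sosD.
  + by move=> J _; apply: sosD; rewrite /sq; case: ifP => [|_];
      by [exact: sJ|exact: tJ|exact: sos0].
  + rewrite {1}pE {1}qE.
    have -> : \sum_(J in ps_coll P :|: ps_coll S)
        (sq P J + sq S J) * \prod_(j in J) ineq j =
        \sum_(J in ps_coll P) ps_sq P J * \prod_(j in J) ineq j +
        \sum_(J in ps_coll S) ps_sq S J * \prod_(j in J) ineq j.
      rewrite big_mkcond [in RHS]big_mkcond [X in _ = _ + X]big_mkcond.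
      rewrite -big_split; apply: eq_bigr => J _; rewrite inE /sq.
      by case: (J \in ps_coll P); case: (J \in ps_coll S);
        rewrite /= ?mulrDl ?mul0r ?addr0 ?add0r.
    by rewrite !big_mulDl; ring.
- split=> /=; [exact: deg_leD|exact: deg_leD| |by move=> j; exact: deg_leD].
  by move=> J _; apply: deg_leD; rewrite /sq; case: ifP => [|_];
    by [exact: dJ|exact: eJ|exact: deg0_le].
- by move=> J /=; rewrite inE => /orP[/Pw|/Sw].
Qed.

(** Assuming [r ^+ 2 = 1] treats both signs at once. *)
Lemma PS_monomial Q (c : cutoff_type Q) w d (m : 'X_{1..n + n}) r :
  (mdeg m <= 2 * d)%N -> r ^+ 2 = 1 ->
  PS c w (2 * d) (2 *: (1 - r *: 'X_[m])).
Proof.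
move=> hm r2; have : (mdeg m <= d + d)%N by rewrite (addnn d) -mul2n.
move=> /mnm_split[m1 [m2 [mE h1 h2]]].
pose x : tpoly R n := 'X_[m1]; pose y : tpoly R n := 'X_[m2].
have sx : (msize x <= d.+1)%N by rewrite msizeX.
have sy : (msize y <= d.+1)%N by rewrite msizeX.
have s1 : (msize (1 : tpoly R n) <= d.+1)%N by rewrite msize1.
have sB p q : (msize p <= d.+1)%N -> (msize q <= d.+1)%N ->
    (msize (p - q) <= d.+1)%N.
  by rewrite -!(deg_leE d) => hp hq; exact: rpredB.
have sZ p : (msize p <= d.+1)%N -> (msize (r *: p) <= d.+1)%N.
  by rewrite -!(deg_leE d) => hp; exact: rpredZ.
apply: (@PS_sos Q c w _ ((x - r *: y) ^+ 2 + (1 - x) ^+ 2 + (1 - y) ^+ 2)).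
- by apply: sosD; first apply: sosD; exact: sos_sqr.
- by apply: deg_leD; first apply: deg_leD; apply: deg_le_sqr; apply: sB => //;
    exact: sZ.
- have h : 2 *: (1 - r *: 'X_[m]) \in @deg_le R n (2 * d).
    by rewrite rpredZ// rpredB ?deg_le1// rpredZ// deg_leE msizeX.
  by move: h; rewrite unfold_in.
- rewrite mE mpolyXD -/x -/y.
  have -> : 2 *: (1 - r *: (x * y)) -
      ((x - r *: y) ^+ 2 + (1 - x) ^+ 2 + (1 - y) ^+ 2) =
      (-2) * (x ^+ 2 - x) + (-2) * (y ^+ 2 - y).
    rewrite -!mul_mpolyC.
    have C2 : (2 : R)%:MP = 2 :> tpoly R n by rewrite rmorph_nat.
    have Cr : (r%:MP : tpoly R n) ^+ 2 = 1 by rewrite -rmorphXn /= r2 rmorph1.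
    rewrite C2.
    (* To [ring], [r%:MP] is an atom; the expansion isolates its square so that [Cr] can replace it
       by 1. *)
    have -> : (x - r%:MP * y) ^+ 2 = x ^+ 2 - 2 * (r%:MP * (x * y)) +
      r%:MP ^+ 2 * y ^+ 2 by ring.
    by rewrite Cr; ring.
  by apply: boolean_idealD; apply: boolean_idealM; exact: mpolyX_idem.
Qed.

(** The bound is built monomial by monomial: each term contributes the absolute value of its
    coefficient. *)
Lemma PS_bounded Q (c : cutoff_type Q) w d p : p \in @deg_le R n (2 * d) ->
  exists r, PS c w (2 * d) (r%:MP - p).
Proof.
rewrite deg_leE => /mpolywE ->.
apply: (big_ind (fun p => exists r, PS c w (2 * d) (r%:MP - p))).
- by exists 0; rewrite subr0 mpolyC0; exact: PS0.
- move=> p1 p2 [r1 h1] [r2 h2]; exists (r1 + r2).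
  by rewrite mpolyCD opprD addrACA; exact: PSD.
- move=> m _; set a := p@_m.
  have hm : (mdeg m <= 2 * d)%N by rewrite -ltnS bmdeg.
  have [r [r2 aE]] : exists r, r ^+ 2 = 1 /\ a = `|a| * r.
    have [a0|a0] := leP 0 a.
      by exists 1; rewrite expr1n ger0_norm// mulr1.
    by exists (-1); rewrite sqrrN expr1n ltr0_norm// mulrN1 opprK.
  exists `|a|; rewrite [X in X *: _]aE.
  have -> : `|a|%:MP - (`|a| * r) *: 'X_[m] =
      (`|a| / 2) *: (2 *: (1 - r *: 'X_[m])) :> tpoly R n.
    rewrite scalerA divfK ?pnatr_eq0// scalerBr scalerA.
    by rewrite -[`|a| *: 1]mul_mpolyC mulr1.
  by apply: PSZ; [rewrite divr_ge0|exact: PS_monomial].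
Qed.

End PSCone.

(** * Duality between provable lower bounds and pseudo-expectations *)

Theorem theorem2 (R : realType) (n d : nat) (hd : (0 < d)%N)
    (Q : constraints R n) (c : cutoff_type Q) (hc : is_cutoff c)
    (w : nat) (hw : (0 < w)%N) (p : bpoly R n (2 * d)%N) :
  ereal_sup [set r%:E | r in [set r : R | derives c w (2 * d)%N p r%:MP]]
    = ereal_inf [set (E p)%:E | E in pseudo_expectations c w (2 * d)%N] /\
  (pseudo_expectations c w (2 * d)%N !=set0 ->
   exists E : {scalar bpoly R n (2 * d)%N},
     pseudo_expectations c w (2 * d)%N E /\
     (E p)%:E = ereal_inf [set (E' p)%:E
                          | E' in pseudo_expectations c w (2 * d)%N]).
Proof.
pose C : set (bpoly R n (2 * d)) := fun q => PS c w (2 * d) q.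
pose e := bpoly1 R n (2 * d).
have eE r : bpoly_val (r *: e) = r%:MP.
  by rewrite -[r%:MP]mulr1 mul_mpolyC.
have Cc : convex_cone C.
  split; first exact: PS0; last by move=> a x a0; exact: PSZ.
  by move=> x y; exact: PSD.
have eU : order_unit C e.
  move=> v; have [r hr] := PS_bounded c w (bpolyP v).
  by exists r; move: hr; rewrite -eE.
set S := [set r : R | _]; have SE : S = [set r | C (p - r *: e)].
  by apply/funext => r; rewrite /S /C /derives /mkset -eE.
have weak E r : pseudo_expectations c w (2 * d) E -> S r -> r <= E p.
  rewrite SE => -[E1 E0] /E0.
  by rewrite linearB linearZ /= E1 mulr1 subr_ge0.
have Sne : S !=set0.
  have [r hr] := eU (- p); exists (- r); rewrite SE /mkset.
  by rewrite scaleNr opprK addrC -[p]opprK.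
have [Ce|Ce] := pselect (C (- e)).
  have noE : pseudo_expectations c w (2 * d)
      = set0 :> set {scalar bpoly R n (2 * d)}.
    rewrite -subset0 => E [E1 E0]; have := E0 _ Ce.
    by rewrite linearN E1 oppr_ge0 ler10.
  rewrite noE; split; last by case.
  rewrite image_set0 ereal_inf0; apply: hasNub_ereal_sup => //.
  move=> [b ub]; have [r Sr] := Sne; have rb := ub _ Sr.
  have : S (b + 1); last by move/ub; rewrite gerDl ler10.
  have [_ CD CZ] := Cc; move: Sr; rewrite SE /mkset => Sr.
  (* With [- e] in [C], a provable bound [r] can be raised at will, here past the supposed upper
     bound [b]; the coefficient is nonnegative as [r <= b]. *)
  have -> : p - (b + 1) *: e = (p - r *: e) + (b + 1 - r) *: - e.
    by rewrite scalerN [(b + 1 - r) *: e]scalerBl opprB addrA subrK.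
  by apply: CD => //; apply: CZ => //; rewrite subr_ge0 ler_wpDr.
have [E [E1 E0 Ep]] := state_exists p Cc eU Ce.
have psE : pseudo_expectations c w (2 * d) E by split.
have Ssup : has_sup S by rewrite SE; exact: cone_has_sup.
rewrite -SE in Ep.
(* [E p] equals the supremum of [S], which by [weak] lies below every [E' p]; hence [E] attains the
   infimum. *)
have infE : ereal_inf [set (E' p)%:E | E' in pseudo_expectations c w (2 * d)]
    = (E p)%:E.
  apply/eqP; rewrite eq_le; apply/andP; split.
    by apply: ereal_inf_lbound; exists E.
  apply: le_ereal_inf_tmp => _ [E' psE' <-]; rewrite lee_fin Ep.
  by apply: ge_sup; [case: Ssup|move=> r Sr; exact: weak].
split; last by move=> _; exists E; rewrite infE.
by rewrite infE Ep ereal_sup_EFin//; case: Ssup.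
Qed.
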